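(* Let $\mathcal{M}\neq0$, $l>0$ and $c_3\in\mathbb{R}$ and set $$f(r)=\frac{r^2}{l^2}-\mathcal{M}(1+c_3r)^2 .$$ On a region where $r>0$, $f(r)>0$ and $1+c_3r>0$, consider the 3-dimensional metric $$g=-f\,dt^2+f^{-1}dr^2+r^2d\varphi^2 .$$ Then $\big(M,g_{ab},u,Y,\xi,-2/l^2\big)$ with $$u=-\ln(1+c_3r),\qquad Y=r\,dt\wedge dr,\qquad \xi=\partial_t,$$ is a CKY--RS structure, whose conformal representative $\tilde g=e^{2u}g$ is the BTZ metric $-\tilde f\,dt^2+\tilde f^{-1}d\tilde r^2+\tilde r^2d\varphi^2$ with $\tilde f=\frac{\tilde r^2}{l^2}-\mathcal{M}$ and $\tilde r=e^{u}r$.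
   Context: Conformal Killing--Yano (CKY) 2-form on an $n$-dimensional pseudo-Riemannian manifold: a smooth 2-form $Y_{ab}$ with $\nabla_cY_{ab}=g_{ca}\xi_b-g_{cb}\xi_a+z_{abc}$, where $z_{abc}$ is totally antisymmetric and $\xi_a=\frac{1}{n-1}\nabla^bY_{ba}$; $\xi^a=\xi^a[Y]$ is its associated vector field. CKY--RS structure $(M,g_{ab},u,Y_{ab},\xi^a[Y],\lambda)$: $u\in C^\infty(M)$, $\lambda\in\mathbb{R}$, $Y$ is a CKY 2-form of $g$, $\xi=\xi[Y]$, and $\tilde g_{ab}=e^{2u}g_{ab}$ satisfies $\tilde R_{ab}+\frac12\mathcal{L}_{\xi}\tilde g_{ab}=\lambda\tilde g_{ab}$, $\tilde R_{ab}$ being the Ricci tensor of $\tilde g$. *)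

(* Defs.v *)
From HB Require Import structures.
From mathcomp Require Import all_boot all_order all_algebra.
From mathcomp Require Import all_classical all_reals all_analysis.

Set Implicit Arguments.
Unset Strict Implicit.
Unset Printing Implicit Defensive.
Import Order.TTheory GRing.Theory Num.Theory.
Import numFieldNormedType.Exports.
Local Open Scope classical_set_scope.
Local Open Scope ring_scope.

(* Tensor calculus in a coordinate chart: the manifold is an open set U of R^n
   and a point x has coordinates x 0 i.  A field is a total function on
   'rV[R]_n of which only the values on U matter; since U is open, so do its
   partial derivatives at the points of U.  A vector field (or one-form) is
   given by the row of its components, a tensor field T_ab of type (0,2) by the
   matrix of its components. *)

Section TensorCalculus.
Context {R : realType} {n : nat}.
Local Notation pt := 'rV[R]_n.
Implicit Types (U : set pt) (g T Y : pt -> 'M[R]_n) (X xi : pt -> 'rV[R]_n).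

Definition partial (i : 'I_n) (f : pt -> R) (x : pt) : R :=
  'D_(delta_mx 0 i) f x.

Fixpoint Ck_on (k : nat) U (f : pt -> R) : Prop :=
  (forall x, U x -> {for x, continuous f}) /\
  (if k is k'.+1 then
     forall i : 'I_n, (forall x, U x -> derivable f x (delta_mx 0 i)) /\
                      Ck_on k' U (partial i f)
   else True).

Definition smooth_on U (f : pt -> R) : Prop := forall k, Ck_on k U f.

Definition smooth_tensor2_on U T : Prop :=
  forall a b, smooth_on U (fun x => T x a b).

Definition smooth_map_on U (Phi : pt -> pt) : Prop :=
  forall a, smooth_on U (fun x => Phi x 0 a).

Definition diffeomorphism_on U (V : set pt) (Phi : pt -> pt) : Prop :=
  [/\ open U, open V, smooth_map_on U Phi, Phi @` U = V &
      exists Psi : pt -> pt,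
        smooth_map_on V Psi /\ (forall x, U x -> Psi (Phi x) = x)].

(* The library's Jacobian acts on row vectors, ('J Phi x) i j = d_i Phi^j. *)
Definition pullback (Phi : pt -> pt) T (x : pt) : 'M[R]_n :=
  ('J Phi x) *m T (Phi x) *m ('J Phi x)^T.

Definition pseudo_riemannian U g : Prop :=
  [/\ open U, smooth_tensor2_on U g,
      (forall x, U x -> (g x)^T = g x) &
      (forall x, U x -> g x \in unitmx)].

(* Gamma^a_bc of the Levi-Civita connection; invmx (g x) a d is g^ad. *)
Definition christoffel g (a b c : 'I_n) (x : pt) : R :=
  2^-1 * \sum_d invmx (g x) a d *
    (partial b (fun y => g y d c) x + partial c (fun y => g y d b) x
     - partial d (fun y => g y b c) x).

(* R_ab = d_c Gamma^c_ab - d_b Gamma^c_ac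
          + Gamma^c_cd Gamma^d_ab - Gamma^c_bd Gamma^d_ac,
   the sign convention in which round spheres have positive Ricci tensor. *)
Definition ricci g (x : pt) : 'M[R]_n :=
  \matrix_(a, b)
    (\sum_c (partial c (christoffel g c a b) x
             - partial b (christoffel g c a c) x)
     + \sum_c \sum_d (christoffel g c c d x * christoffel g d a b x
                      - christoffel g c b d x * christoffel g d a c x)).

(* nabla_c T_ab *)
Definition cov_deriv g T (c a b : 'I_n) (x : pt) : R :=
  partial c (fun y => T y a b) x
  - \sum_d christoffel g d c a x * T x d b
  - \sum_d christoffel g d c b x * T x a d.

(* (L_X T)_ab = X^c d_c T_ab + T_cb d_a X^c + T_ac d_b X^c *)
Definition lie_deriv X T (x : pt) : 'M[R]_n :=
  \matrix_(a, b) \sum_c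
    (X x 0 c * partial c (fun y => T y a b) x
     + T x c b * partial a (fun y => X y 0 c) x
     + T x a c * partial b (fun y => X y 0 c) x).

(* xi_a = (n - 1)^-1 nabla^b Y_ba *)
Definition cky_covector g Y (a : 'I_n) (x : pt) : R :=
  (n.-1)%:R^-1 * \sum_b \sum_c invmx (g x) b c * cov_deriv g Y c b a x.

(* xi^a = g^ab xi_b *)
Definition cky_vector g Y (x : pt) : 'rV[R]_n :=
  \row_a \sum_b invmx (g x) a b * cky_covector g Y b x.

Definition two_form_on U Y : Prop :=
  smooth_tensor2_on U Y /\ (forall x, U x -> (Y x)^T = - Y x).

Definition totally_antisymmetric_on U (z : 'I_n -> 'I_n -> 'I_n -> pt -> R) :=
  forall x, U x -> forall a b c,
    z a b c x = - z b a c x /\ z a b c x = - z a c b x.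

Definition cky_two_form U g Y : Prop :=
  two_form_on U Y /\
  exists z, totally_antisymmetric_on U z /\
    forall x, U x -> forall a b c,
      cov_deriv g Y c a b x =
        g x c a * cky_covector g Y b x - g x c b * cky_covector g Y a x
        + z a b c x.

Definition conformal (u : pt -> R) g (x : pt) : 'M[R]_n :=
  expR (2 * u x) *: g x.

Definition cky_rs_structure U g (u : pt -> R) Y xi (lambda : R) : Prop :=
  [/\ pseudo_riemannian U g,
      smooth_on U u,
      cky_two_form U g Y,
      (forall x, U x -> xi x = cky_vector g Y x) &
      (forall x, U x ->
         ricci (conformal u g) x + 2^-1 *: lie_deriv xi (conformal u g) x
         = lambda *: conformal u g x)].

(* Components of the coordinate vector field d/dx^i and of the one-form dx^i *)
Definition coord_vec (i : 'I_n) : 'rV[R]_n := delta_mx 0 i.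
Definition coord_form (i : 'I_n) : 'rV[R]_n := delta_mx 0 i.

Definition tensor_form (al be : 'rV[R]_n) : 'M[R]_n := al^T *m be.

(* Normalised without factor 1/2: al /\ be = al (x) be - be (x) al. *)
Definition wedge (al be : 'rV[R]_n) : 'M[R]_n :=
  tensor_form al be - tensor_form be al.

End TensorCalculus.

(* The coordinates (t, r, phi) on R^3 *)
Definition it : 'I_3 := @Ordinal 3 0 isT.
Definition ir : 'I_3 := @Ordinal 3 1 isT.
Definition iphi : 'I_3 := @Ordinal 3 2 isT.

(* - F(r) dt^2 + F(r)^-1 dr^2 + r^2 dphi^2 *)
Definition static_metric {R : realType} (F : R -> R) (x : 'rV[R]_3) : 'M[R]_3 :=
  let r := x 0 ir in
  (- F r) *: tensor_form (coord_form it) (coord_form it)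
  + (F r)^-1 *: tensor_form (coord_form ir) (coord_form ir)
  + r ^+ 2 *: tensor_form (coord_form iphi) (coord_form iphi).

(* (t, r, phi) |-> (t, rho(t, r, phi), phi) *)
Definition change_r {R : realType} (rho : 'rV[R]_3 -> R) (x : 'rV[R]_3)
  : 'rV[R]_3 :=
  \row_i (if i == ir then rho x else x 0 i).

(* Main.v *)
Require Import Defs.
From HB Require Import structures.
From mathcomp Require Import all_boot all_order all_algebra.
From mathcomp Require Import all_classical all_reals all_analysis.
From mathcomp Require Import ring.
Import Order.TTheory GRing.Theory Num.Theory.
Import numFieldNormedType.Exports.
Local Open Scope classical_set_scope.
Local Open Scope ring_scope.

(* All fields involved depend on r alone and the metrics g and g~ = e^{2u} g are
   diagonal.  For a diagonal metric depending on one coordinate the Christoffel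
   symbols and the Ricci tensor are rational in the coefficients and their first
   two derivatives; for g~ this yields Ric = -(2 / l^2) g~.  Since d/dt is a
   Killing vector of g~, the Lie derivative vanishes.  The conformal
   Killing-Yano equation holds with z = 0 for every static metric
   - F dt^2 + dr^2 / F + r^2 dphi^2, whatever F is.  Finally
   r |-> e^u r = r / (1 + c3 r) has inverse s |-> s / (1 - c3 s), and pulling the
   BTZ metric back along it is a substitution, because its derivative is
   (1 + c3 r)^-2. *)

Set Implicit Arguments.
Unset Strict Implicit.

(** * Partial derivatives and smooth functions *)

Section PartialDerivatives.
Context {R : realType} {n : nat}.
Implicit Types (U V : set 'rV[R]_n) (f g : 'rV[R]_n -> R) (x : 'rV[R]_n).

Lemma eq_on_near {T : Type} (U : set 'rV[R]_n) (f g : 'rV[R]_n -> T) x :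
  open U -> (forall y, U y -> f y = g y) -> U x -> \near x, f x = g x.
Proof.
move=> oU fg Ux; have nU : nbhs x U by exact: open_nbhs_nbhs.
by near do apply: fg.
Unshelve. all: by end_near. Qed.

Lemma eq_on_continuous U f g x : open U -> (forall y, U y -> f y = g y) ->
  U x -> {for x, continuous f} -> {for x, continuous g}.
Proof.
move=> oU fg Ux cf; suff : g @ x --> g x by [].
rewrite -(fg _ Ux); apply: cvg_trans cf.
exact: (@near_eq_cvg _ _ (nbhs x) (nbhs_filter x) f g (eq_on_near oU fg Ux)).
Qed.

(** A partial derivative depends only on the germ at [x]. This is what allows a field to be
    replaced, before differentiating, by a closed form valid on [U] only. *)
Lemma partial_eq_on U f g i x : open U ->
  (forall y, U y -> f y = g y) -> U x -> partial i f x = partial i g x.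
Proof. by move=> oU fg Ux; apply: near_eq_derive; exact: eq_on_near Ux. Qed.

Lemma is_derive_coord (j : 'I_n) x (v : 'rV[R]_n) :
  is_derive x v (fun y : 'rV[R]_n => y 0 j) (v 0 j).
Proof.
have d : derivable (fun y : 'rV[R]_n => y 0 j) x v.
  by apply: diff_derivable; exact: differentiable_coord.
apply: DeriveDef => //.
by have := derive_id x v; rewrite derive_mx ?derivable_id// => /rowP/(_ j); rewrite mxE.
Qed.

(** Directional derivatives alone do not compose, so the chain rule is taken for the total
    differential, which for the one-variable [h] exists as soon as the derivative does. *)
Lemma is_derive_comp_coord (h : R -> R) (dh : R) (j : 'I_n) x (v : 'rV[R]_n) :
  is_derive (x 0 j) 1 h dh ->
  is_derive x v (fun y : 'rV[R]_n => h (y 0 j)) (v 0 j * dh).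
Proof.
move=> [/derivable1_diffP dfh eh].
have dc := differentiable_coord x 0 j.
have dhc : differentiable (h \o (fun y : 'rV[R]_n => y 0 j)) x.
  exact: differentiable_comp.
apply: DeriveDef; first exact: diff_derivable.
rewrite (deriveE _ dhc) diff_comp//= diff1E//= -(deriveE v dc).
by rewrite (@derive_val _ _ _ _ _ _ _ (is_derive_coord j x v)) derive1E eh.
Qed.

Lemma partial_comp_coord (h : R -> R) (dh : R) (i j : 'I_n) x :
  is_derive (x 0 j) 1 h dh ->
  partial i (fun y => h (y 0 j)) x = (i == j)%:R * dh.
Proof.
move=> H; rewrite /partial (@derive_val _ _ _ _ _ _ _ (is_derive_comp_coord (delta_mx 0 i) H)).
by rewrite mxE eqxx/= eq_sym.
Qed.

Lemma partial_cst (c : R) i x : partial i (fun=> c) x = 0.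
Proof. exact: derive_cst. Qed.

End PartialDerivatives.

Section SmoothFunctions.
Context {R : realType} {n : nat}.
Implicit Types (U V : set 'rV[R]_n) (f g : 'rV[R]_n -> R) (x : 'rV[R]_n).

Lemma Ck_onS k U f : Ck_on k.+1 U f -> Ck_on k U f.
Proof.
elim: k f => [|k IH] f [cf df]; first by split.
by split=> // i; have [di Ci] := df i; split=> //; exact: IH.
Qed.

Lemma sub_Ck_on k U V f : U `<=` V -> Ck_on k V f -> Ck_on k U f.
Proof.
move=> UV; elim: k f => [|k IH] f [cf df]; (split; first by move=> x /UV /cf) => //.
by move=> i; have [di Ci] := df i; split=> [x /UV /di|] //; exact: IH.
Qed.

Lemma eq_Ck_on k U f g : open U -> (forall x, U x -> f x = g x) ->
  Ck_on k U f -> Ck_on k U g.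
Proof.
move=> oU; elim: k f g => [|k IH] f g fg [cf df].
  by split=> // x Ux; exact: (eq_on_continuous oU fg Ux (cf _ Ux)).
split=> [x Ux|i]; first exact: (eq_on_continuous oU fg Ux (cf _ Ux)).
have [di Ci] := df i; split.
  by move=> x Ux; apply: near_eq_derivable (di _ Ux); exact: eq_on_near Ux.
by apply: IH Ci => x Ux; exact: partial_eq_on Ux.
Qed.

Lemma Ck_on_cst k U (c : R) : Ck_on k U (fun=> c).
Proof.
elim: k c => [|k IH] c; (split; first by move=> x _; exact: cst_continuous) => //.
move=> i; split=> [x _|]; first exact: derivable_cst.
by rewrite (_ : partial i _ = fun=> 0) //; apply/funext => x; exact: partial_cst.
Qed.

Lemma Ck_on_coord k U (j : 'I_n) : Ck_on k U (fun x => x 0 j).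
Proof.
case: k => [|k]; (split; first by move=> x _; exact: coord_continuous) => //.
move=> i; split=> [x _|]; first by case: (is_derive_coord j x (delta_mx 0 i)).
rewrite (_ : partial i _ = fun=> (delta_mx 0 i : 'rV[R]_n) 0 j); first exact: Ck_on_cst.
by apply/funext => x; case: (is_derive_coord j x (delta_mx 0 i)).
Qed.

Lemma Ck_onD k U f g : open U -> Ck_on k U f -> Ck_on k U g ->
  Ck_on k U (fun x => f x + g x).
Proof.
move=> oU; elim: k f g => [|k IH] f g [cf df] [cg dg].
  by split=> // x Ux; apply: continuousD; [exact: cf|exact: cg].
split=> [x Ux|i]; first by apply: continuousD; [exact: cf|exact: cg].
have [dfi Cf] := df i; have [dgi Cg] := dg i; split.
  by move=> x Ux; apply: derivableD; [exact: dfi|exact: dgi].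
apply: eq_Ck_on (IH _ _ Cf Cg) => // x Ux.
by rewrite /partial -deriveD//; [exact: dfi|exact: dgi].
Qed.

(** The Leibniz rule brings back [f] and [g] themselves next to their partial derivatives; [Ck_onS]
    lowers them by one order, so the induction closes. *)
Lemma Ck_onM k U f g : open U -> Ck_on k U f -> Ck_on k U g ->
  Ck_on k U (fun x => f x * g x).
Proof.
move=> oU; elim: k f g => [|k IH] f g Cf Cg; have [cf df] := Cf; have [cg dg] := Cg.
  by split=> // x Ux; apply: continuousM; [exact: cf|exact: cg].
split=> [x Ux|i]; first by apply: continuousM; [exact: cf|exact: cg].
have [dfi Cfi] := df i; have [dgi Cgi] := dg i; split.
  by move=> x Ux; apply: derivableM; [exact: dfi|exact: dgi].
apply: (@eq_Ck_on _ _ (fun x => f x * partial i g x + g x * partial i f x)) => //.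
  by move=> x Ux; rewrite /partial [RHS]deriveM//; [exact: dfi|exact: dgi].
by apply: Ck_onD => //; apply: IH => //; exact: Ck_onS.
Qed.

(** The partial derivatives are - (1/f)^2 d_i f, where 1/f already has the lower order by induction;
    [f] therefore stays fixed while the order varies. *)
Lemma Ck_onV k U f : open U -> (forall x, U x -> f x != 0) -> Ck_on k U f ->
  Ck_on k U (fun x => (f x)^-1).
Proof.
move=> oU f0; elim: k => [|k IH] Cf; have [cf df] := Cf.
  by split=> // x Ux; apply: continuousV; [exact: f0|exact: cf].
split=> [x Ux|i]; first by apply: continuousV; [exact: f0|exact: cf].
have [dfi Cfi] := df i; split.
  by move=> x Ux; apply: derivableV; [exact: f0|exact: dfi].
have CV := IH (Ck_onS Cf).
apply: (@eq_Ck_on _ _ (fun x => -1 * ((f x)^-1 * (f x)^-1) * partial i f x)) => //.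
  move=> x Ux; rewrite /partial [RHS]deriveV//; [|exact: f0|exact: dfi].
  by rewrite mulN1r -invfM -expr2.
by do ?apply: Ck_onM => //; exact: Ck_on_cst.
Qed.

(** Gaining one order from the derivative reduces the smoothness of a logarithm to that of a
    rational function. *)
Lemma Ck_on_comp_coord k U (h dh : R -> R) (j : 'I_n) : open U ->
  (forall x, U x -> is_derive (x 0 j) 1 h (dh (x 0 j))) ->
  Ck_on k U (fun x => dh (x 0 j)) -> Ck_on k.+1 U (fun x => h (x 0 j)).
Proof.
move=> oU hd Cd; split=> [x Ux|i].
  apply: (@differentiable_continuous _ _ _ x (h \o (fun y : 'rV[R]_n => y 0 j))).
  apply: differentiable_comp; first exact: differentiable_coord.
  by apply/derivable1_diffP; case: (hd _ Ux).
split=> [x Ux|]; first by case: (is_derive_comp_coord (delta_mx 0 i) (hd _ Ux)).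
apply: (@eq_Ck_on _ _ (fun x => (i == j)%:R * dh (x 0 j))) => //.
  by move=> x Ux; rewrite (partial_comp_coord i (hd _ Ux)).
by apply: Ck_onM => //; exact: Ck_on_cst.
Qed.

Lemma eq_smooth_on U f g : open U -> (forall x, U x -> f x = g x) ->
  smooth_on U f -> smooth_on U g.
Proof. by move=> oU fg Sf k; exact: eq_Ck_on (Sf k). Qed.

Lemma smooth_on_cst U (c : R) : smooth_on U (fun=> c).
Proof. by move=> k; exact: Ck_on_cst. Qed.

Lemma smooth_on_coord U (j : 'I_n) : smooth_on U (fun x => x 0 j).
Proof. by move=> k; exact: Ck_on_coord. Qed.

Lemma smooth_onD U f g : open U -> smooth_on U f -> smooth_on U g ->
  smooth_on U (fun x => f x + g x).
Proof. by move=> oU Sf Sg k; exact: Ck_onD. Qed.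

Lemma smooth_onM U f g : open U -> smooth_on U f -> smooth_on U g ->
  smooth_on U (fun x => f x * g x).
Proof. by move=> oU Sf Sg k; exact: Ck_onM. Qed.

Lemma smooth_onN U f : open U -> smooth_on U f -> smooth_on U (fun x => - f x).
Proof.
move=> oU Sf; apply: (@eq_smooth_on _ (fun x => -1 * f x)) => //.
  by move=> x _; rewrite mulN1r.
by apply: smooth_onM => //; exact: smooth_on_cst.
Qed.

Lemma smooth_onV U f : open U -> (forall x, U x -> f x != 0) ->
  smooth_on U f -> smooth_on U (fun x => (f x)^-1).
Proof. by move=> oU f0 Sf k; exact: Ck_onV. Qed.

Lemma smooth_onX U f m : open U -> smooth_on U f ->
  smooth_on U (fun x => f x ^+ m).
Proof.
move=> oU Sf; elim: m => [|m IH]; first exact: smooth_on_cst.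
apply: (@eq_smooth_on _ (fun x => f x * f x ^+ m)) => //.
  by move=> x _; rewrite exprS.
exact: smooth_onM.
Qed.

End SmoothFunctions.

(** * Diagonal metrics depending on one coordinate *)

Section Congruence.
Context {R : realType} {n : nat}.
Implicit Types (U : set 'rV[R]_n) (g : 'rV[R]_n -> 'M[R]_n).

Lemma christoffel_eq_on U g g' a b c x : open U ->
  (forall y, U y -> g y = g' y) -> U x ->
  christoffel g a b c x = christoffel g' a b c x.
Proof.
move=> oU gg' Ux; rewrite /christoffel gg'//; congr (_ * _); apply: eq_bigr => d _.
have E i j k : partial i (fun y => g y j k) x = partial i (fun y => g' y j k) x.
  by apply: (partial_eq_on _ oU) => // y Uy; rewrite gg'.
by rewrite !E.
Qed.

(** The Christoffel symbols are differentiated once more, so they must be compared on all of [U] and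
    not merely at [x]. *)
Lemma ricci_eq_on U g g' x : open U ->
  (forall y, U y -> g y = g' y) -> U x -> ricci g x = ricci g' x.
Proof.
move=> oU gg' Ux; apply/matrixP => a b; rewrite [LHS]mxE [RHS]mxE.
have E i j k y : U y -> christoffel g i j k y = christoffel g' i j k y.
  exact: (christoffel_eq_on _ _ _ oU).
have E' m i j k : partial m (christoffel g i j k) x = partial m (christoffel g' i j k) x.
  by apply: (partial_eq_on _ oU) => // y Uy; exact: E.
apply: (f_equal2 +%R); first by apply: eq_bigr => c _; rewrite !E'.
by apply: eq_bigr => c _; apply: eq_bigr => d _; rewrite !(E _ _ _ x).
Qed.

Lemma lie_deriv_eq_on U X g g' x : open U ->
  (forall y, U y -> g y = g' y) -> U x -> lie_deriv X g x = lie_deriv X g' x.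
Proof.
move=> oU gg' Ux; apply/matrixP => a b; rewrite [LHS]mxE [RHS]mxE.
have E i j k : partial i (fun y => g y j k) x = partial i (fun y => g' y j k) x.
  by apply: (partial_eq_on _ oU) => // y Uy; rewrite gg'.
by apply: eq_bigr => c _; rewrite gg'// E.
Qed.

End Congruence.

Section DiagonalMatrix.
Context {F : fieldType} {n : nat}.

Lemma mul_diag_mxV (d : 'rV[F]_n) : (forall i, d 0 i != 0) ->
  diag_mx d *m diag_mx (\row_i (d 0 i)^-1) = 1%:M.
Proof.
move=> d0; rewrite mulmx_diag -diag_const_mx; congr diag_mx.
by apply/rowP => i; rewrite !mxE mulfV.
Qed.

Lemma unitmx_diag (d : 'rV[F]_n) : (forall i, d 0 i != 0) -> diag_mx d \in unitmx.
Proof. by move=> /mul_diag_mxV /mulmx1_unit[]. Qed.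

Lemma invmx_diag (d : 'rV[F]_n) : (forall i, d 0 i != 0) ->
  invmx (diag_mx d) = diag_mx (\row_i (d 0 i)^-1).
Proof.
by move=> d0; rewrite -[RHS](mulKmx (unitmx_diag d0)) mul_diag_mxV// mulmx1.
Qed.

End DiagonalMatrix.

Lemma is_deriveV1 {R : realType} (h : R -> R) (s dh : R) : h s != 0 ->
  is_derive s 1 h dh -> is_derive s 1 (fun r => (h r)^-1) (- dh / h s ^+ 2).
Proof.
move=> h0 [dd eh]; apply: DeriveDef; first exact: derivableV.
by rewrite deriveV// eh mulNr -mulrN mulrC; congr (_ * _); rewrite /GRing.scale/= mulrC.
Qed.

Section DiagonalMetric.
Context {R : realType} {n : nat}.
Variables (U : set 'rV[R]_n) (j : 'I_n) (h h1 h2 : 'I_n -> R -> R).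
Hypothesis oU : open U.
Hypothesis h0 : forall x, U x -> forall a, h a (x 0 j) != 0.
Hypothesis hD : forall x, U x -> forall a, is_derive (x 0 j) 1 (h a) (h1 a (x 0 j)).
Hypothesis h1D : forall x, U x -> forall a, is_derive (x 0 j) 1 (h1 a) (h2 a (x 0 j)).

Definition diag_metric (x : 'rV[R]_n) : 'M[R]_n := diag_mx (\row_i h i (x 0 j)).

(* Gamma^a_bc = (christoffel_up * h_a' - christoffel_dn * h_b') / (2 h_a), where
   the second term comes from - d_a g_bc. *)
Definition christoffel_up (a b c : 'I_n) : R :=
  ((a == c) && (b == j))%:R + ((a == b) && (c == j))%:R.
Definition christoffel_dn (a b c : 'I_n) : R := ((b == c) && (a == j))%:R.

Definition diag_christoffel (a b c : 'I_n) (s : R) : R :=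
  2^-1 * ((h a s)^-1 * (christoffel_up a b c * h1 a s - christoffel_dn a b c * h1 b s)).

Definition diag_dchristoffel (a b c : 'I_n) (s : R) : R :=
  2^-1 * ((h a s)^-1 * (christoffel_up a b c * h2 a s - christoffel_dn a b c * h2 b s)
  - h1 a s / h a s ^+ 2 * (christoffel_up a b c * h1 a s - christoffel_dn a b c * h1 b s)).

Lemma invmx_diag_metric x : U x ->
  invmx (diag_metric x) = diag_mx (\row_i (h i (x 0 j))^-1).
Proof.
move=> Ux; rewrite invmx_diag => [|i]; last by rewrite mxE h0.
by congr diag_mx; apply/rowP => i; rewrite !mxE.
Qed.

Lemma partial_diag_metric x i a b : U x ->
  partial i (fun y => diag_metric y a b) x = ((i == j) && (a == b))%:R * h1 a (x 0 j).
Proof.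
move=> Ux.
have -> : (fun y => diag_metric y a b) = fun y => (fun s => h a s * (a == b)%:R) (y 0 j).
  by apply/funext => y; rewrite !mxE mulr_natr.
case: (a == b); last first.
  rewrite andbF mul0r -[RHS](partial_cst 0 i x); congr (partial _ _ _).
  by apply/funext => y; rewrite mulr0.
rewrite andbT -(partial_comp_coord i (hD Ux a)); congr (partial _ _ _).
by apply/funext => y; rewrite mulr1.
Qed.

Lemma christoffel_diag a b c x : U x ->
  christoffel diag_metric a b c x = diag_christoffel a b c (x 0 j).
Proof.
move=> Ux; rewrite /christoffel /diag_christoffel invmx_diag_metric//; congr (_ * _).
rewrite (bigD1 a)//= [X in _ + X]big1 ?addr0; last first.
  by move=> d da; rewrite !mxE eq_sym (negbTE da) mulr0n mul0r.
rewrite !mxE eqxx mulr1n; congr (_ * _).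
rewrite !partial_diag_metric// /christoffel_up /christoffel_dn mulrDl.
rewrite (andbC (b == j)) (andbC (c == j)) (andbC (a == j)).
by [].
Qed.

Lemma is_derive_diag_christoffel a b c x : U x ->
  is_derive (x 0 j) 1 (diag_christoffel a b c) (diag_dchristoffel a b c (x 0 j)).
Proof.
move=> Ux.
have dV := is_deriveV1 (h0 Ux a) (hD Ux a).
have da := h1D Ux a; have db := h1D Ux b.
(* Written with operations on functions, the symbol has a derivative that instance resolution
   assembles from [dV], [da] and [db]. *)
have -> : diag_christoffel a b c =
    2^-1 \*: ((fun s => (h a s)^-1)
             * (christoffel_up a b c \*: h1 a - christoffel_dn a b c \*: h1 b)) by [].
apply: is_derive_eq.
rewrite /diag_dchristoffel /GRing.scale/=; congr (_ * _).
rewrite mulNr mulrN; congr (_ - _); first exact: mulrC.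
Qed.

Lemma partial_christoffel_diag i a b c x : U x ->
  partial i (christoffel diag_metric a b c) x = (i == j)%:R * diag_dchristoffel a b c (x 0 j).
Proof.
move=> Ux; rewrite -(partial_comp_coord i (is_derive_diag_christoffel a b c Ux)).
by apply: (partial_eq_on _ oU) => // y Uy; exact: christoffel_diag.
Qed.

Definition diag_ricci (a b : 'I_n) (s : R) : R :=
  \sum_c ((c == j)%:R * diag_dchristoffel c a b s
          - (b == j)%:R * diag_dchristoffel c a c s)
  + \sum_c \sum_d (diag_christoffel c c d s * diag_christoffel d a b s
                  - diag_christoffel c b d s * diag_christoffel d a c s).

Lemma ricci_diag x a b : U x -> ricci diag_metric x a b = diag_ricci a b (x 0 j).
Proof.
move=> Ux; rewrite mxE; apply: (f_equal2 +%R).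
  by apply: eq_bigr => c _; rewrite !partial_christoffel_diag.
by apply: eq_bigr => c _; apply: eq_bigr => d _; rewrite !christoffel_diag.
Qed.

(** The field has constant components and the coefficients do not depend on the coordinate [i], so
    it is a Killing vector. *)
Lemma lie_deriv_coord_diag i x : U x -> i != j ->
  lie_deriv (fun=> coord_vec i) diag_metric x = 0.
Proof.
move=> Ux ij; apply/matrixP => a b; rewrite !mxE big1// => c _.
rewrite !partial_cst !mulr0 !addr0 partial_diag_metric// mxE eqxx/=.
by have [->|] := eqVneq c i; rewrite ?mul0r// (negbTE ij) mul0r mulr0.
Qed.

End DiagonalMetric.

(** * The Ricci tensor of the BTZ metric *)

Section ThreeCoordinates.

(** The cases are the named indices themselves, so that [eq_ord3] can decide every Kronecker
    delta. *)
Lemma ord3_ind (P : 'I_3 -> Prop) : P it -> P ir -> P iphi -> forall i, P i.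
Proof.
move=> Pt Pr Pphi [[|[|[|//]]] i3].
- by rewrite (_ : Ordinal i3 = it) //; exact: val_inj.
- by rewrite (_ : Ordinal i3 = ir) //; exact: val_inj.
- by rewrite (_ : Ordinal i3 = iphi) //; exact: val_inj.
Qed.

Lemma big_ord3 (V : nmodType) (F : 'I_3 -> V) :
  \sum_(i < 3) F i = F it + F ir + F iphi.
Proof.
by rewrite !big_ord_recl big_ord0 addr0 addrA; congr (F _ + F _ + F _); exact: val_inj.
Qed.

Lemma eq_ord3 : ((it == it) = true) * ((it == ir) = false) * ((it == iphi) = false)
  * ((ir == it) = false) * ((ir == ir) = true) * ((ir == iphi) = false)
  * ((iphi == it) = false) * ((iphi == ir) = false) * ((iphi == iphi) = true).
Proof. by []. Qed.

Definition by_coord {T : Type} (a b c : T) (i : 'I_3) : T :=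
  if i == it then a else if i == ir then b else c.

End ThreeCoordinates.

Section StaticRicci.
Context {R : realType}.
Variables (h h1 h2 : 'I_3 -> R -> R) (s : R).
Hypothesis h0 : forall a, h a s != 0.
Local Notation A := (h it s).
Local Notation B := (h ir s).
Local Notation C := (h iphi s).
Local Notation A1 := (h1 it s).
Local Notation B1 := (h1 ir s).
Local Notation C1 := (h1 iphi s).
Local Notation A2 := (h2 it s).
Local Notation B2 := (h2 ir s).
Local Notation C2 := (h2 iphi s).

(** This concerns A dt^2 + B dr^2 + C dphi^2 with A, B, C functions of r. The reflections of t and
    of phi are isometries, which is why the off-diagonal components vanish. *)
Lemma diag_ricci3 a b :
  diag_ricci ir h h1 h2 a b s
  = (a == b)%:R * by_coord
     (- A2 / (2 * B) + A1 * B1 / (4 * B ^+ 2) + A1 ^+ 2 / (4 * A * B)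
      - A1 * C1 / (4 * B * C))
     (- A2 / (2 * A) - C2 / (2 * C) + A1 ^+ 2 / (4 * A ^+ 2) + C1 ^+ 2 / (4 * C ^+ 2)
      + A1 * B1 / (4 * A * B) + B1 * C1 / (4 * B * C))
     (- C2 / (2 * B) + C1 * B1 / (4 * B ^+ 2) + C1 ^+ 2 / (4 * B * C)
      - A1 * C1 / (4 * A * B)) a.
Proof.
have := h0 it; have := h0 ir; have := h0 iphi.
rewrite /diag_ricci !big_ord3 /diag_christoffel /diag_dchristoffel.
rewrite /christoffel_up /christoffel_dn /by_coord.
(* The nine values are generalized to variables, leaving for each component an identity of rational
   functions. *)
elim/ord3_ind: a; elim/ord3_ind: b; rewrite !eq_ord3 /=;
  move: A B C A1 B1 C1 A2 B2 C2 => A B C A1 B1 C1 A2 B2 C2 C0 B0 A0;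
  by field; rewrite ?A0 ?B0 ?C0.
Qed.

End StaticRicci.

(** * Differentiation of rational functions of one variable *)

Section RealDerivatives.
Context {R : realType}.
Implicit Types (f g : R -> R) (s a b : R).

Lemma is_derive1D f g s a b : is_derive s 1 f a -> is_derive s 1 g b ->
  is_derive s 1 (fun r => f r + g r) (a + b).
Proof. exact: is_deriveD. Qed.

Lemma is_derive1N f s a : is_derive s 1 f a -> is_derive s 1 (fun r => - f r) (- a).
Proof. exact: is_deriveN. Qed.

Lemma is_derive1M f g s a b : is_derive s 1 f a -> is_derive s 1 g b ->
  is_derive s 1 (fun r => f r * g r) (f s * b + g s * a).
Proof. exact: is_deriveM. Qed.

Lemma is_derive1X f n s a : is_derive s 1 f a ->
  is_derive s 1 (fun r => f r ^+ n) (n%:R * f s ^+ n.-1 * a).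
Proof.
move=> df; rewrite (_ : (fun r => _) = f ^+ n); last by apply/funext => r; rewrite fctE.
exact: is_deriveX.
Qed.

End RealDerivatives.

(** The derivative is left as an existential variable and built along the structure of the
    expression; there remain the nonvanishing of denominators and one algebraic identity with the
    expected value. *)
Ltac derive_rational :=
  eapply is_derive_eq; [repeat first
    [ exact: is_derive_cst | exact: is_derive_id | eapply is_derive1D
    | eapply is_derive1N | eapply is_derive1M | eapply is_derive1X
    | eapply is_deriveV1 ] | ].

Section StaticMetric.
Context {R : realType}.
Implicit Types (x : 'rV[R]_3).

Lemma tensor_formE (al be : 'rV[R]_3) a b : tensor_form al be a b = al 0 a * be 0 b.
Proof. by rewrite mxE big_ord1 mxE. Qed.

Lemma static_metricE (F : R -> R) x : static_metric F x =
  diag_metric ir (by_coord (fun s => - F s) (fun s => (F s)^-1) (fun s => s ^+ 2)) x.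
Proof.
apply/matrixP => a b; rewrite !(tensor_formE, mxE).
by elim/ord3_ind: a; elim/ord3_ind: b; rewrite /by_coord !eq_ord3 /=;
  rewrite !(mulr0, mul0r, mulr1, addr0, add0r, mulr0n, mulr1n).
Qed.

Section BTZ.
Variables (M l c3 : R).
Local Notation w s := (1 + c3 * s).
Local Notation F s := (s ^+ 2 / l ^+ 2 - M * w s ^+ 2).
Local Notation F1 s := (2 * s / l ^+ 2 - 2 * c3 * M * w s).
Local Notation F2 := (2 / l ^+ 2 - 2 * c3 ^+ 2 * M).

(* The diagonal of e^{2u} g, where e^u = 1 / (1 + c3 s). *)
Definition btz_coef : 'I_3 -> R -> R := by_coord
  (fun s => M - s ^+ 2 / (w s ^+ 2 * l ^+ 2))
  (fun s => (F s * w s ^+ 2)^-1)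
  (fun s => s ^+ 2 / w s ^+ 2).

(** The numerators for t and phi are short because w s - c3 s = 1; the radial entry is the
    derivative of a reciprocal, with [F1] the derivative of [F]. *)
Definition btz_coef1 : 'I_3 -> R -> R := by_coord
  (fun s => - (2 * s) / (w s ^+ 3 * l ^+ 2))
  (fun s => - (F1 s * w s ^+ 2 + 2 * c3 * w s * F s) / (F s * w s ^+ 2) ^+ 2)
  (fun s => 2 * s / w s ^+ 3).

Definition btz_coef2 : 'I_3 -> R -> R := by_coord
  (fun s => - (2 * (1 - 2 * c3 * s)) / (w s ^+ 4 * l ^+ 2))
  (fun s => - (F2 * w s ^+ 2 + 4 * c3 * w s * F1 s + 2 * c3 ^+ 2 * F s) / (F s * w s ^+ 2) ^+ 2
    + 2 * (F1 s * w s ^+ 2 + 2 * c3 * w s * F s) ^+ 2 / (F s * w s ^+ 2) ^+ 3)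
  (fun s => 2 * (1 - 2 * c3 * s) / w s ^+ 4).

Variable s : R.
Hypotheses (l0 : l != 0) (s0 : s != 0) (w0 : w s != 0) (F0 : F s != 0).

Lemma btz_coef_neq0 a : btz_coef a s != 0.
Proof.
elim/ord3_ind: a; rewrite /btz_coef /by_coord !eq_ord3.
(* The form of the coefficient that is easy to differentiate hides the factor [F s], from which the
   nonvanishing comes. *)
- rewrite (_ : M - _ = - (F s / w s ^+ 2)); last by field; rewrite w0 l0.
  by rewrite oppr_eq0 mulf_neq0// invr_eq0 expf_neq0.
- by rewrite invr_eq0 mulf_neq0// expf_neq0.
- by rewrite mulf_neq0 ?invr_eq0 ?expf_neq0.
Qed.

Lemma is_derive_btz_coef a : is_derive s 1 (btz_coef a) (btz_coef1 a s).
Proof.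
have W2 : w s ^+ 2 != 0 by rewrite expf_neq0.
have L2 : l ^+ 2 != 0 by rewrite expf_neq0.
elim/ord3_ind: a; rewrite /btz_coef /btz_coef1 /by_coord !eq_ord3;
  (* Once differentiation is done, [F s] becomes an atom, so that [field] meets its nonvanishing as
     the side condition [q0]. *)
  derive_rational; rewrite ?mulf_neq0 //=; move: (F s) F0 => q q0;
  by field; rewrite ?w0 ?l0 ?q0.
Qed.

Lemma is_derive_btz_coef1 a : is_derive s 1 (btz_coef1 a) (btz_coef2 a s).
Proof.
have W m : w s ^+ m != 0 by rewrite expf_neq0.
have L2 : l ^+ 2 != 0 by rewrite expf_neq0.
have FW : (F s * w s ^+ 2) ^+ 2 != 0 by rewrite expf_neq0// mulf_neq0.
elim/ord3_ind: a; rewrite /btz_coef1 /btz_coef2 /by_coord !eq_ord3;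
  derive_rational; rewrite ?mulf_neq0 //=; move: (F s) F0 => q q0;
  by field; rewrite ?w0 ?l0 ?q0.
Qed.

(** The BTZ metric has constant curvature -1/l^2, which in dimension 3 means Ric = -(2/l^2) times
    the metric. The code verifies this by substitution into [diag_ricci3]. *)
Lemma btz_coef_einstein a b :
  diag_ricci ir btz_coef btz_coef1 btz_coef2 a b s
  = - (2 / l ^+ 2) * (btz_coef a s *+ (a == b)).
Proof.
rewrite diag_ricci3; last exact: btz_coef_neq0.
rewrite -[X in _ = _ * X]mulr_natl [RHS]mulrCA; congr (_ * _).
have A : btz_coef it s = - (F s / w s ^+ 2).
  by rewrite /btz_coef /by_coord !eq_ord3; field; rewrite w0 l0.
(* The denominators involve F s, so it becomes the variable q and M is eliminated. *)
have [q Eq] : exists q, F s = q by exists (F s).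
have q0 : q != 0 by rewrite -Eq.
have EM : M = (s ^+ 2 / l ^+ 2 - q) / w s ^+ 2 by rewrite -Eq; field; rewrite w0 l0.
elim/ord3_ind: a; rewrite /by_coord ?eq_ord3 ?A;
  rewrite /btz_coef /btz_coef1 /btz_coef2 /by_coord !eq_ord3 ?Eq EM;
  by field; rewrite ?w0 ?l0 ?q0 ?s0.
Qed.

End BTZ.

End StaticMetric.

(** * The conformal Killing-Yano form r dt /\ dr *)

Section StaticCKY.
Context {R : realType}.
Variables (U : set 'rV[R]_3) (F F1 : R -> R).
Hypothesis oU : open U.
Hypothesis r0 : forall x, U x -> x 0 ir != 0.
Hypothesis F0 : forall x, U x -> F (x 0 ir) != 0.
Hypothesis FD : forall x, U x -> is_derive (x 0 ir) 1 F (F1 (x 0 ir)).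

Definition static_coef : 'I_3 -> R -> R :=
  by_coord (fun s => - F s) (fun s => (F s)^-1) (fun s => s ^+ 2).
Definition static_coef1 : 'I_3 -> R -> R :=
  by_coord (fun s => - F1 s) (fun s => - F1 s / F s ^+ 2) (fun s => 2 * s).

Lemma static_coef_neq0 x : U x -> forall a, static_coef a (x 0 ir) != 0.
Proof.
move=> Ux; elim/ord3_ind; rewrite /static_coef /by_coord !eq_ord3.
- by rewrite oppr_eq0 F0.
- by rewrite invr_eq0 F0.
- by rewrite expf_neq0// r0.
Qed.

Lemma is_derive_static_coef x : U x ->
  forall a, is_derive (x 0 ir) 1 (static_coef a) (static_coef1 a (x 0 ir)).
Proof.
move=> Ux; have dF := FD Ux; elim/ord3_ind;
  rewrite /static_coef /static_coef1 /by_coord !eq_ord3.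
- exact: (is_derive1N dF).
- by apply: is_deriveV1 => //; exact: F0.
- by derive_rational; rewrite /=; ring.
Qed.

Definition rdtdr (x : 'rV[R]_3) : 'M[R]_3 :=
  x 0 ir *: wedge (coord_form it) (coord_form ir).

Definition tr_sign (a b : 'I_3) : R :=
  ((a == it) && (b == ir))%:R - ((a == ir) && (b == it))%:R.

Lemma rdtdrE x a b : rdtdr x a b = x 0 ir * tr_sign a b.
Proof.
rewrite mxE; congr (_ * _).
by rewrite /wedge [LHS]mxE [X in _ + X]mxE !tensor_formE !mxE !eqxx /= -!natrM !mulnb.
Qed.

Lemma partial_rdtdr c a b x :
  partial c (fun y => rdtdr y a b) x = (c == ir)%:R * tr_sign a b.
Proof.
have -> : (fun y => rdtdr y a b) = fun y => y 0 ir * tr_sign a b.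
  by apply/funext => y; rewrite rdtdrE.
have d : is_derive (x 0 ir) 1 (fun s => s * tr_sign a b) (tr_sign a b).
  by derive_rational; rewrite mulr0 add0r mulr1.
exact: partial_comp_coord d.
Qed.

Lemma static_metric_entry x a b :
  static_metric F x a b = (a == b)%:R * static_coef a (x 0 ir).
Proof. by rewrite static_metricE !mxE mulr_natl. Qed.

Lemma static_inv x : U x ->
  invmx (static_metric F x) = diag_mx (\row_i (static_coef i (x 0 ir))^-1).
Proof.
by move=> Ux; rewrite static_metricE (invmx_diag_metric static_coef_neq0).
Qed.

(** The right-hand side is g_ca xi_b - g_cb xi_a for xi_a = g_ta, the lowered d/dt. The t-r block
    has determinant -1, hence Gamma^t_rt + Gamma^r_rr = 0 and the derivative of [F] cancels. *)
Lemma cov_deriv_rdtdr c a b x : U x ->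
  cov_deriv (static_metric F) rdtdr c a b x =
    (c == a)%:R * static_coef a (x 0 ir) * ((b == it)%:R * static_coef b (x 0 ir))
  - (c == b)%:R * static_coef b (x 0 ir) * ((a == it)%:R * static_coef a (x 0 ir)).
Proof.
move=> Ux; rewrite /cov_deriv.
have -> : static_metric F = diag_metric ir static_coef.
  by apply/funext => y; exact: static_metricE.
rewrite !big_ord3 !(christoffel_diag static_coef_neq0 is_derive_static_coef _ _ _ Ux).
rewrite partial_rdtdr !rdtdrE /diag_christoffel /christoffel_up /christoffel_dn /tr_sign.
have := r0 Ux; have := F0 Ux; rewrite /static_coef /static_coef1 /by_coord.
by elim/ord3_ind: a; elim/ord3_ind: b; elim/ord3_ind: c; rewrite !eq_ord3 /=;
  move: (F (x 0 ir)) (F1 (x 0 ir)) (x 0 ir) => f f1 s f0 s0; field; rewrite ?f0 ?s0.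
Qed.

(** Contracting g_cb xi_a - g_ca xi_b with g^bc gives 3 xi_a - xi_a, and the factor 2 is the
    normalisation n - 1. *)
Lemma cky_covector_rdtdr a x : U x ->
  cky_covector (static_metric F) rdtdr a x = (a == it)%:R * static_coef a (x 0 ir).
Proof.
move=> Ux; rewrite /cky_covector static_inv// !big_ord3 !cov_deriv_rdtdr// !mxE.
have := static_coef_neq0 Ux it; have := static_coef_neq0 Ux ir.
have := static_coef_neq0 Ux iphi.
by elim/ord3_ind: a; rewrite !eq_ord3 /=;
  move: (static_coef it _) (static_coef ir _) (static_coef iphi _) => A B C C0 B0 A0;
  field; rewrite ?A0 ?B0 ?C0.
Qed.

Lemma cky_vector_rdtdr x : U x -> cky_vector (static_metric F) rdtdr x = coord_vec it.
Proof.
move=> Ux; apply/rowP => a; rewrite [LHS]mxE static_inv// big_ord3 !cky_covector_rdtdr// !mxE.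
have h0 := static_coef_neq0 Ux it.
by elim/ord3_ind: a; rewrite !eq_ord3 /= !(mul0r, mulr0, addr0, mul1r)
  ?mulr1n ?mulr0n ?mul0r ?mulVf.
Qed.

Lemma two_form_rdtdr : two_form_on U rdtdr.
Proof.
split=> [a b|x Ux].
  apply: (eq_smooth_on (f := fun x => x 0 ir * tr_sign a b)) => //.
    by move=> x _; rewrite rdtdrE.
  by apply: smooth_onM => //; [exact: smooth_on_coord|exact: smooth_on_cst].
apply/matrixP => a b; rewrite [LHS]mxE [RHS]mxE !rdtdrE -mulrN opprB /tr_sign.
by rewrite (andbC (b == it)) (andbC (b == ir)).
Qed.

Lemma cky_rdtdr : cky_two_form U (static_metric F) rdtdr.
Proof.
split; first exact: two_form_rdtdr.
exists (fun _ _ _ _ => 0); split=> [x _ a b c|x Ux a b c]; first by rewrite oppr0.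
rewrite cov_deriv_rdtdr// !cky_covector_rdtdr// addr0 !static_metric_entry.
(* Metric entries carry the coefficient of the row index, the covariant derivative that of the
   column index; under the Kronecker delta they agree. *)
have E i : (c == i)%:R * static_coef c (x 0 ir) = (c == i)%:R * static_coef i (x 0 ir).
  by have [->|] := eqVneq c i; rewrite ?mul0r.
by rewrite !E.
Qed.

Lemma static_metric_pseudo_riemannian : smooth_on U (fun x => F (x 0 ir)) ->
  pseudo_riemannian U (static_metric F).
Proof.
move=> SF; split=> [//|a b|x Ux|x Ux].
- apply: (eq_smooth_on (f := fun x => static_coef a (x 0 ir) * (a == b)%:R)) => //.
    by move=> x _; rewrite static_metricE -/static_coef !mxE mulr_natr.
  apply: smooth_onM => //; last exact: smooth_on_cst.
  elim/ord3_ind: a; rewrite /static_coef /by_coord !eq_ord3.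
  + exact: smooth_onN.
  + exact: smooth_onV.
  + by apply: smooth_onX => //; exact: smooth_on_coord.
- by rewrite static_metricE tr_diag_mx.
- rewrite static_metricE unitmx_diag// => i; rewrite mxE; exact: static_coef_neq0.
Qed.

End StaticCKY.

(** * Change of the radial coordinate *)

Section ChangeOfRadius.
Context {R : realType}.
Implicit Types (h : R -> R) (dh : R) (x : 'rV[R]_3).

Lemma change_rE h x a :
  change_r (fun y => h (y 0 ir)) x 0 a = (if a == ir then h else id) (x 0 a).
Proof. by rewrite mxE; case: eqVneq => [->|]. Qed.

(** The map is the identity plus a scalar multiple of a constant vector in the r direction, so only
    the scalar has to be differentiated. *)
Lemma differentiable_change_r h dh x : is_derive (x 0 ir) 1 h dh ->
  differentiable (change_r (fun y => h (y 0 ir))) x.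
Proof.
move=> [/derivable1_diffP dfh _].
have -> : change_r (fun y => h (y 0 ir)) =
    fun y => y + (h (y 0 ir) - y 0 ir) *: (delta_mx 0 ir : 'rV[R]_3).
  apply/funext => y; apply/rowP => a; rewrite !mxE eqxx /=.
  by case: eqVneq => [->|_]; rewrite /= ?mulr1 ?mulr0 ?addr0// addrC subrK.
have dc := differentiable_coord x 0 ir.
apply: differentiableD => //; apply: differentiableZl.
apply: differentiableB => //.
exact: (@differentiable_comp _ _ _ _ (fun y : 'rV[R]_3 => y 0 ir) h).
Qed.

Lemma jacobian_change_r h dh x : is_derive (x 0 ir) 1 h dh ->
  'J (change_r (fun y => h (y 0 ir))) x = diag_mx (\row_i (if i == ir then dh else 1)).
Proof.
move=> hD; have dP := differentiable_change_r hD.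
apply/row_matrixP => i; rewrite !rowE -deriveEjacobian// derive_mx; last first.
  exact: diff_derivable.
apply/rowP => j; rewrite mxE -rowE !mxE.
have D : is_derive (x 0 j) 1 (if j == ir then h else id) (if j == ir then dh else 1).
  by case: eqVneq => [->|_] //; exact: is_derive_id.
rewrite (_ : (if i == ir then _ else _) *+ (i == j) =
  (i == j)%:R * (if j == ir then dh else 1)); last first.
  by case: (eqVneq i j) => [->|]; rewrite ?mulr1n ?mulr0n ?mul1r ?mul0r.
have E : (fun y => change_r (fun z => h (z 0 ir)) y 0 j) =
    (fun y => (if j == ir then h else id) (y 0 j)).
  by apply/funext => y; rewrite change_rE.
by rewrite E; exact: partial_comp_coord D.
Qed.

Lemma pullback_change_r h dh (F : R -> R) x : is_derive (x 0 ir) 1 h dh ->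
  pullback (change_r (fun y => h (y 0 ir))) (static_metric F) x =
  diag_mx (\row_i by_coord (- F (h (x 0 ir))) (dh ^+ 2 / F (h (x 0 ir))) (h (x 0 ir) ^+ 2) i).
Proof.
move=> hD; rewrite /pullback (jacobian_change_r hD) static_metricE tr_diag_mx !mulmx_diag.
congr diag_mx; apply/rowP => i; rewrite !mxE eqxx.
by elim/ord3_ind: i; rewrite /by_coord !eq_ord3 /= ?mul1r ?mulr1 // expr2 mulrAC.
Qed.

Lemma smooth_change_r U (rho : 'rV[R]_3 -> R) : smooth_on U rho ->
  smooth_map_on U (change_r rho).
Proof.
move=> Srho a; rewrite (_ : (fun x => _) = if a == ir then rho else fun x => x 0 a).
  by case: ifP => _ //; exact: smooth_on_coord.
by apply/funext => x; rewrite mxE; case: ifP.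
Qed.

(** The set [D] is a domain on which the candidate inverse [hi] is explicit and smooth; it may
    exceed the range of [h] on [U], so that range is never computed. *)
Lemma change_r_diffeomorphism U h hi (D : set R) : open U -> open D ->
  smooth_on U (fun x => h (x 0 ir)) ->
  smooth_on [set y : 'rV[R]_3 | D (y 0 ir)] (fun y => hi (y 0 ir)) ->
  (forall s, D s -> exists d, is_derive s 1 hi d) ->
  (forall x, U x -> D (h (x 0 ir)) /\ hi (h (x 0 ir)) = x 0 ir) ->
  (forall s, D s -> h (hi s) = s) ->
  exists V, diffeomorphism_on U V (change_r (fun x => h (x 0 ir))).
Proof.
move=> oU oD Sh Shi dhi hK hiK.
pose Phi : 'rV[R]_3 -> 'rV[R]_3 := change_r (fun x => h (x 0 ir)).
pose Psi : 'rV[R]_3 -> 'rV[R]_3 := change_r (fun x => hi (x 0 ir)).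
pose E : set 'rV[R]_3 := [set y | D (y 0 ir)].
have PhiK x : U x -> Psi (Phi x) = x.
  move=> Ux; apply/rowP => a; rewrite change_rE.
  by case: eqVneq => [->|ar]; rewrite change_rE ?eqxx ?(negbTE ar)//; have [] := hK _ Ux.
have PsiK y : E y -> Phi (Psi y) = y.
  move=> Ey; apply/rowP => a; rewrite change_rE.
  by case: eqVneq => [->|ar]; rewrite change_rE ?eqxx ?(negbTE ar)//; exact: hiK.
(* The image is a preimage under [Psi] cut down to [E], hence open by continuity of [Psi] there,
   without the inverse function theorem. *)
have VE : Phi @` U = E `&` Psi @^-1` U.
  apply/seteqP; split=> [_ [x Ux <-]|y [Ey Uy]].
    by split; rewrite /E /= ?PhiK// change_rE eqxx; have [] := hK _ Ux.
  by exists (Psi y) => //; exact: PsiK.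
have oE : open E.
  by apply: (open_comp (f := fun y : 'rV[R]_3 => y 0 ir)) => // y _; exact: coord_continuous.
have oV : open (Phi @` U).
  rewrite VE openE => y [Ey Uy]; apply: filterI; first exact: open_nbhs_nbhs.
  have [d hid] := dhi _ Ey.
  apply: (differentiable_continuous (differentiable_change_r hid)).
  exact: open_nbhs_nbhs.
exists (Phi @` U); split=> //; first exact: smooth_change_r.
exists Psi; split=> // a k.
apply: (sub_Ck_on (V := E)); first by rewrite VE => y [].
exact: smooth_change_r.
Qed.

End ChangeOfRadius.

(** * The conformal factor and the rescaled radius *)

Section LogFactor.
Context {R : realType}.
Variable c : R.
Local Notation w s := (1 + c * s).

Lemma is_derive_affine (s : R) : is_derive s 1 (fun r => w r) c.
Proof. by derive_rational; rewrite mulr0 !addr0 add0r mulr1. Qed.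

Lemma is_derive_ln_affine (s : R) : 0 < w s ->
  is_derive s 1 (fun r => - ln (w r)) (- (c / w s)).
Proof.
move=> w0; apply: is_derive1N; rewrite [c / _]mulrC.
exact: (is_derive1_comp (f := @ln R) (g := fun r => w r)
  (is_derive1_ln w0) (is_derive_affine s)).
Qed.

Lemma expR_ln_affine (s : R) : 0 < w s -> expR (- ln (w s)) = (w s)^-1.
Proof. by move=> w0; rewrite expRN lnK. Qed.

(** The product rule gives 1/w - c s/w^2, and w - c s = 1. *)
Lemma is_derive_expR_ln_affine (s : R) : 0 < w s ->
  is_derive s 1 (fun r => expR (- ln (w r)) * r) (w s ^- 2).
Proof.
move=> w0; have w1 : w s != 0 by rewrite gt_eqF.
have dE := is_derive1_comp (f := @expR R) (g := fun r => - ln (w r))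
  (is_derive_expR _) (is_derive_ln_affine w0).
apply: (is_derive_eq (is_derive1M dE (is_derive_id s 1))).
by rewrite /= expR_ln_affine//; field.
Qed.

Lemma smooth_ln_affine n (U : set 'rV[R]_n) (j : 'I_n) : open U ->
  (forall x, U x -> 0 < w (x 0 j)) -> smooth_on U (fun x => - ln (w (x 0 j))).
Proof.
move=> oU w0 k; apply: Ck_onS.
apply: (Ck_on_comp_coord (h := fun r => - ln (w r)) (dh := fun r => - (c / w r))) => //.
  by move=> x Ux; apply: is_derive_ln_affine; exact: w0.
suff : smooth_on U (fun x => - (c / w (x 0 j))) by [].
apply: smooth_onN => //; apply: smooth_onM => //; first exact: smooth_on_cst.
apply: smooth_onV => //; first by move=> x Ux; rewrite gt_eqF ?w0.
apply: smooth_onD => //; first exact: smooth_on_cst.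
by apply: smooth_onM => //; [exact: smooth_on_cst|exact: smooth_on_coord].
Qed.

End LogFactor.

(** * The CKY--RS equation and the identification with BTZ *)

Unset Implicit Arguments.

Theorem mainTheorem17 (R : realType) (M l c3 : R) (hM : M != 0) (hl : 0 < l)
  (f : R -> R)
  (hf : f = fun r => r ^+ 2 / l ^+ 2 - M * (1 + c3 * r) ^+ 2)
  (U : set 'rV[R]_3) (hU : open U)
  (hreg : forall x, U x ->
     [/\ 0 < x 0 ir, 0 < f (x 0 ir) & 0 < 1 + c3 * x 0 ir])
  (g : 'rV[R]_3 -> 'M[R]_3) (hg : g = static_metric f)
  (u : 'rV[R]_3 -> R) (hu : u = fun x => - ln (1 + c3 * x 0 ir))
  (Y : 'rV[R]_3 -> 'M[R]_3)
  (hY : Y = fun x => x 0 ir *: wedge (coord_form it) (coord_form ir))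
  (xi : 'rV[R]_3 -> 'rV[R]_3) (hxi : xi = fun _ => coord_vec it)
  (rt : 'rV[R]_3 -> R) (hrt : rt = fun x => expR (u x) * x 0 ir)
  (ft : R -> R) (hft : ft = fun s => s ^+ 2 / l ^+ 2 - M) :
  cky_rs_structure U g u Y xi (- (2 / l ^+ 2)) /\
  (exists V : set 'rV[R]_3,
     diffeomorphism_on U V (change_r rt) /\
     (forall x, U x ->
        conformal u g x = pullback (change_r rt) (static_metric ft) x)).
Proof.
have l0 : l != 0 by rewrite gt_eqF.
have r0 x : U x -> x 0 ir != 0 by move=> /hreg[? _ _]; rewrite gt_eqF.
have f0 x : U x -> f (x 0 ir) != 0 by move=> /hreg[_ ? _]; rewrite gt_eqF.
have w_gt0 x : U x -> 0 < 1 + c3 * x 0 ir by move=> /hreg[].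
have w0 x : U x -> 1 + c3 * x 0 ir != 0 by move=> /w_gt0 ?; rewrite gt_eqF.
pose f1 r := 2 * r / l ^+ 2 - 2 * c3 * M * (1 + c3 * r).
have fD x : U x -> is_derive (x 0 ir) 1 f (f1 (x 0 ir)).
  by move=> _; rewrite hf /f1; derive_rational; rewrite /=; field.
have Sr : smooth_on U (fun x => x 0 ir) by exact: smooth_on_coord.
have Sw : smooth_on U (fun x => 1 + c3 * x 0 ir).
  by apply: smooth_onD => //; [|apply: smooth_onM => //]; exact: smooth_on_cst.
have Sf : smooth_on U (fun x => f (x 0 ir)).
  rewrite hf; apply: smooth_onD => //.
    by apply: smooth_onM => //; [exact: smooth_onX|exact: smooth_on_cst].
  apply: smooth_onN => //; apply: smooth_onM => //; first exact: smooth_on_cst.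
  exact: smooth_onX.
(* Here e^{2u} = (1 + c3 r)^-2, which needs the positivity available on [U]; elsewhere the two
   metrics may differ. *)
have gtE x : U x -> conformal u g x = diag_metric ir (btz_coef M l c3) x.
  move=> Ux; rewrite /conformal hg static_metricE /diag_metric -linearZ/=.
  congr diag_mx; apply/rowP => i; rewrite !mxE.
  rewrite hu expRM_natl expR_ln_affine ?w_gt0//.
  have := w0 _ Ux; have := f0 _ Ux; rewrite hf /btz_coef /by_coord.
  move=> F0 W0; elim/ord3_ind: i; rewrite !eq_ord3 /=.
  - by field; rewrite l0 W0.
  - by rewrite [in RHS]invfM mulrC exprVn.
  - by rewrite exprVn mulrC.
have c0 x : U x -> forall a, btz_coef M l c3 a (x 0 ir) != 0.
  by move=> Ux a; apply: btz_coef_neq0; rewrite ?r0 ?w0//; have := f0 _ Ux; rewrite hf.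
have c1 x : U x -> forall a,
    is_derive (x 0 ir) 1 (btz_coef M l c3 a) (btz_coef1 M l c3 a (x 0 ir)).
  by move=> Ux a; apply: is_derive_btz_coef; rewrite ?r0 ?w0//; have := f0 _ Ux; rewrite hf.
have c2 x : U x -> forall a,
    is_derive (x 0 ir) 1 (btz_coef1 M l c3 a) (btz_coef2 M l c3 a (x 0 ir)).
  by move=> Ux a; apply: is_derive_btz_coef1; rewrite ?r0 ?w0//; have := f0 _ Ux; rewrite hf.
split.
  split.
  - by rewrite hg; exact: (static_metric_pseudo_riemannian hU r0 f0).
  - by rewrite hu; exact: smooth_ln_affine.
  - by rewrite hg hY; exact: (cky_rdtdr (F1 := f1) hU r0 f0 fD).
  - by move=> x Ux; rewrite hxi hg hY [RHS](cky_vector_rdtdr (F1 := f1) r0 f0 fD Ux).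
  - move=> x Ux; rewrite (ricci_eq_on hU gtE Ux) (lie_deriv_eq_on xi hU gtE Ux).
    rewrite hxi (lie_deriv_coord_diag c1 Ux)// scaler0 addr0 gtE//.
    apply/matrixP => a b; rewrite (ricci_diag hU c0 c1 c2 _ _ Ux).
    rewrite btz_coef_einstein ?r0 ?w0//; last by have := f0 _ Ux; rewrite hf.
    by rewrite !mxE.
pose h s := expR (- ln (1 + c3 * s)) * s.
have rtE : rt = fun x => h (x 0 ir) by rewrite hrt hu.
have hE s : 0 < 1 + c3 * s -> h s = s / (1 + c3 * s).
  by move=> ?; rewrite /h expR_ln_affine// mulrC.
have hD s : 0 < 1 + c3 * s -> is_derive s 1 h ((1 + c3 * s) ^- 2).
  exact: is_derive_expR_ln_affine.
(* This is a domain for the inverse s / (1 - c3 s). It contains the new radii, since 1 - c3 s = 1 /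
   (1 + c3 r) > 0 at s = r / (1 + c3 r). *)
pose D : set R := [set s | 0 < 1 - c3 * s].
have D0 s : D s -> 1 - c3 * s != 0 by move=> ?; rewrite gt_eqF.
have oD : open D.
  rewrite (_ : D = (fun s : R => 1 - c3 * s) @^-1` [set y | 0 < y])//.
  apply: open_comp; last exact: open_gt.
  by move=> s _; apply: continuousB; [exact: cst_continuous|exact: mulrl_continuous].
have [V dV] : exists V, diffeomorphism_on U V (change_r (fun x => h (x 0 ir))).
  apply: (@change_r_diffeomorphism _ _ h (fun s => s / (1 - c3 * s)) D) => //.
  - apply: (eq_smooth_on (f := fun x => x 0 ir / (1 + c3 * x 0 ir))) => //.
      by move=> x Ux; rewrite hE ?w_gt0.
    by apply: smooth_onM => //; exact: smooth_onV.
  - have oE : open [set y : 'rV[R]_3 | D (y 0 ir)].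
      apply: (open_comp (f := fun y : 'rV[R]_3 => y 0 ir)) => // y _.
      exact: coord_continuous.
    apply: smooth_onM => //; first exact: smooth_on_coord.
    apply: smooth_onV => //; first by move=> x; exact: D0.
    apply: smooth_onD => //; first exact: smooth_on_cst.
    apply: smooth_onN => //; apply: smooth_onM => //; first exact: smooth_on_cst.
    exact: smooth_on_coord.
  - move=> s Ds; have d := D0 _ Ds; exists ((1 - c3 * s) ^- 2).
    by derive_rational => //=; field.
  - move=> x Ux; have W0 := w0 _ Ux; rewrite hE ?w_gt0//.
    have e : 1 - c3 * (x 0 ir / (1 + c3 * x 0 ir)) = (1 + c3 * x 0 ir)^-1 by field.
    by split; rewrite /D /= e ?invr_gt0 ?w_gt0// invrK mulfVK.
  - move=> s Ds; have d := D0 _ Ds.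
    have e : 1 + c3 * (s / (1 - c3 * s)) = (1 - c3 * s)^-1 by field.
    by rewrite hE e ?invr_gt0// invrK mulfVK.
exists V; rewrite rtE; split=> // x Ux.
rewrite gtE// (pullback_change_r _ (hD _ (w_gt0 _ Ux))) hE ?w_gt0// hft.
congr diag_mx; apply/rowP => i; rewrite !mxE.
have := w0 _ Ux; have := f0 _ Ux; rewrite hf /btz_coef /by_coord.
pose F r := r ^+ 2 / l ^+ 2 - M * (1 + c3 * r) ^+ 2.
move=> F0 W0; elim/ord3_ind: i; rewrite !eq_ord3 /=.
- by field; rewrite l0 W0.
(* Evaluated at the new radius, [ft] is F(r) / w^2, so the radial coefficient becomes w^-4 / (F /
   w^2) = 1 / (F w^2), with w = 1 + c3 r. *)
- rewrite (_ : (_ / _) ^+ 2 / _ - M = F (x 0 ir) / (1 + c3 * x 0 ir) ^+ 2).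
    by rewrite -/(F _); move: F0; rewrite -/(F _); move: (F _) => q q0; field; rewrite q0 W0.
  by rewrite /F; field; rewrite l0 W0.
- by rewrite expr_div_n.
Qed.
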